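(* Let $X$ be the Markov mixture process on $\mathbb{S}=E\cup\{\Delta\}$, let $\Gamma_1,\dots,\Gamma_p$ be nonempty stochastically closed subsets of $\mathbb{S}$ with $\bigcap_{l=1}^p\Gamma_l=\{\Delta\}$, and $\tau_l=\inf\{t\ge0:X_t\in\Gamma_l\}$. Let $t_{i_p}\ge\dots\ge t_{i_1}\ge t_{i_0}=t\ge0$ be the time ordering of $(t_1,\dots,t_p)\in\mathbb{R}_+^p$, where $(i_1,\dots,i_p)$ is a permutation of $(1,\dots,p)$. Then for $j\in E$ the joint distribution of the first exit times $\{\tau_l\}$ is $$\overline F_{j,t}(t_{i_1},\dots,t_{i_p})=\mathbb{P}\big\{\tau_{i_1}>t_{i_1},\dots,\tau_{i_p}>t_{i_p}\mid\mathcal{F}_{t,j}\big\}=\sum_{k=1}^m\mathbf{e}_j^{\top}\mathbf{S}^{(k)}(t)\Big(\prod_{l=1}^p e^{\mathbf{B}^{(k)}(t_{i_l}-t_{i_{l-1}})}\mathbf{H}_{i_l}\Big)\mathbb{1},$$ with $\sum_{k=1}^m\mathbf{S}^{(k)}(t)=\mathbf{I}$, where the matrix product is ordered from left ($l=1$) to right ($l=p$) and $\mathbf{H}_{i_l}$ is the $n\times n$ diagonal matrix whose $i$th diagonal element is $1$ if $i\in\Gamma_{i_l}^c$ and $0$ otherwise.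
   Context: Mixture process: $E=\{1,\dots,n\}$ are the transient states, $\Delta=n+1$ is the absorbing state, $\mathbb{S}=E\cup\{\Delta\}$. For $k=1,\dots,m$, $\mathbf{Q}^{(k)}=\begin{pmatrix}\mathbf{B}^{(k)}&-\mathbf{B}^{(k)}\mathbb{1}\\ \mathbf{0}&0\end{pmatrix}$ is an intensity matrix on $\mathbb{S}$ (nonnegative off-diagonal entries, zero row sums) with $\mathbf{B}^{(k)}$ an $n\times n$ nonsingular matrix. On a probability space there are an unobserved regime $\phi\in\{1,\dots,m\}$ and an $\mathbb{S}$-valued right-continuous process $X=(X_t)_{t\ge0}$ such that $\mathbb{P}\{X_0=i\}=\pi_i$ for $i\in E$, $\mathbb{P}\{X_0=\Delta\}=0$, $\mathbb{P}\{\phi=k\mid X_0=i\}=s_i^{(k)}$ with $\sum_k s_i^{(k)}=1$, and, given $\phi=k$ and $X_0=i$, $X$ is a time-homogeneous Markov jump process with intensity matrix $\mathbf{Q}^{(k)}$ started at $i$. Closed sets: $\Gamma_l$ stochastically closed means $[\mathbf{Q}^{(k)}]_{i,j}=0$ for all $k$ whenever $i\in\Gamma_l$, $j\in\Gamma_l^c$. It is assumed that $\pi_i\ne0$ for $i\in\bigcap_l\Gamma_l^c$ and $\mathbb{P}\{\tau_1>0,\dots,\tau_p>0\}=1$. Information: $\mathcal{F}_{t-}$ is any sub-$\sigma$-field of $\sigma(X_s:0\le s<t)$ (full, partial, or no information). $\mathcal{F}_{t,j}$ denotes $\mathcal{F}_{t-}$ together with $X_t=j$: $\mathbb{P}\{A\mid\mathcal{F}_{t,j}\}:=\mathbb{P}\{A\cap\{X_t=j\}\mid\mathcal{F}_{t-}\}/\mathbb{P}\{X_t=j\mid\mathcal{F}_{t-}\}$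 where the denominator is positive; identities are almost sure there. $\mathbf{S}^{(k)}(t)=\mathrm{diag}(s_1^{(k)}(t),\dots,s_n^{(k)}(t))$ with $s_j^{(k)}(t)=\mathbb{P}\{\phi=k\mid\mathcal{F}_{t,j}\}$ (completed arbitrarily to nonnegative weights summing to $1$ over $k$ where undefined). $\mathbf{e}_j$ is the $j$th unit vector, $\mathbb{1}$ the all-ones vector. *)

(* Defs.v *)
(* MathComp-Analysis, over an arbitrary [R : realType]. *)
From HB Require Import structures.
From mathcomp Require Export all_boot all_order all_algebra perm.
From mathcomp Require Export all_classical all_reals all_analysis.

Set Implicit Arguments.
Unset Strict Implicit.
Unset Printing Implicit Defensive.

Import Order.TTheory GRing.Theory Num.Theory.
Import numFieldNormedType.Exports.

Local Open Scope classical_set_scope.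
Local Open Scope ring_scope.

(* The state space S = E u {Delta} is ['I_(n + 1)], so that intensity matrices
   are 2x2 block matrices. *)
Notation state n := 'I_(n + 1).

Definition trans n (i : 'I_n) : state n := lshift 1 i.

Definition absorb n : state n := rshift n ord0.

Section Matrices.
Context {R : realType}.

Definition expm n (A : 'M[R]_n) : 'M[R]_n :=
  \matrix_(i, j) limn (series (fun k => (A ^+ k) i j / k`!%:R)).

Definition intensity_matrix N (Q : 'M[R]_N) : Prop :=
  (forall x y, x != y -> 0 <= Q x y) /\ (forall x, \sum_y Q x y = 0).

Definition absorbing_generator n (B : 'M[R]_n) : 'M[R]_(n + 1) :=
  block_mx B (- (B *m const_mx 1)) 0 0.

Definition stoch_closed n m (B : 'I_m -> 'M[R]_n) (G : {set state n}) : Prop :=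
  forall k x y, x \in G -> y \notin G -> absorbing_generator (B k) x y = 0.

Definition outside_mx n (G : {set state n}) : 'M[R]_n :=
  diag_mx (\row_i (trans i \notin G)%:R).

(* [p] is the transition function of a Markov jump process with intensity
   matrix [Q]: a semigroup of stochastic matrices with right derivative [Q]
   at time 0.  Its values at negative times are irrelevant. *)
Record transition_function N (Q : 'M[R]_N) (p : R -> 'M[R]_N) : Prop := {
  transition_ge0 : forall u, 0 <= u -> forall x y, 0 <= p u x y;
  transition_sum1 : forall u, 0 <= u -> forall x, \sum_y p u x y = 1;
  transition_at0 : p 0 = 1%:M;
  transition_semigroup : forall u v, 0 <= u -> 0 <= v ->
    p (u + v) = p u *m p v;
  transition_generator : forall x y,
    (h^-1 * (p h x y - (1%:M : 'M[R]_N) x y)) @[h --> 0^'+] --> Q x y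
}.

End Matrices.

Section Processes.
Context {R : realType} {T : Type}.

(* Elementary conditional probability; meaningful when [0 < mu D]. *)
Definition cond_pr (mu : set T -> R) (D A : set T) : R :=
  mu (A `&` D) / mu D.

(* [mu] is a (real-valued) probability.  Time is indexed by [R], but only the
   times [>= 0] matter, here and below.  [past] lists finitely many
   observations (time, state). *)
Record markov_jump N (mu : set T -> R) (X : R -> T -> 'I_N) (Q : 'M[R]_N)
    (x0 : 'I_N) : Prop := {
  markov_jump_start : mu [set w | X 0 w = x0] = 1;
  markov_jump_markov : exists2 p, transition_function Q p &
    forall (u v : R) (x y : 'I_N) (past : seq (R * 'I_N)),
      0 <= u -> 0 <= v -> (forall q, q \in past -> 0 <= q.1 <= u) ->
      let D := [set w | X u w = x /\ forall q, q \in past -> X q.1 w = q.2] in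
      0 < mu D -> cond_pr mu D [set w | X (u + v) w = y] = p v x y
}.

Definition right_continuous_paths (S : Type) (X : R -> T -> S) : Prop :=
  forall w t, 0 <= t -> \forall u \near t^'+, X u w = X t w.

(* The sigma-field generated by X_s, 0 <= s < t. *)
Definition sigma_before (S : Type) (X : R -> T -> S) (t : R) : set (set T) :=
  <<s [set A | exists2 s, 0 <= s < t & exists Y : set S, A = X s @^-1` Y] >>.

Definition entry_time N (X : R -> T -> 'I_N) (G : {set 'I_N}) (w : T) : \bar R :=
  ereal_inf [set u%:E | u in [set u : R | 0 <= u /\ X u w \in G]].

End Processes.

Section Conditioning.
Context {R : realType} {d : measure_display} {T : measurableType d}.

(* [cp A] is a version of the conditional probability P(A | F), for every
   event [A]. *)
Definition cond_prob_given (P : probability T R) (F : set (set T))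
    (cp : set T -> T -> R) : Prop :=
  forall A, measurable A ->
    [/\ forall Y : set R, measurable Y -> F (cp A @^-1` Y),
        P.-integrable setT (EFin \o cp A)
      & forall B, F B -> (\int[P]_(w in B) (cp A w)%:E = P (A `&` B))%E].

(* P(A | F_{t,j}) at [w]; meaningful where [0 < cp [set w | X t w = j] w]. *)
Definition cond_prob_at N (cp : set T -> T -> R) (X : R -> T -> 'I_N)
    (t : R) (j : 'I_N) (A : set T) (w : T) : R :=
  cp (A `&` [set w | X t w = j]) w / cp [set w | X t w = j] w.

(* [c k i w] is the completion used where P(X_t = i | F) vanishes. *)
Definition regime_mx n m (cp : set T -> T -> R) (phi : T -> 'I_m)
    (X : R -> T -> state n) (t : R) (c : 'I_m -> 'I_n -> T -> R)
    (k : 'I_m) (w : T) : 'M[R]_n :=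
  diag_mx (\row_i
    if 0 < cp [set w | X t w = trans i] w
    then cond_prob_at cp X t (trans i) [set w | phi w = k] w
    else c k i w).

Record mixture_process n m (P : probability T R) (phi : T -> 'I_m)
    (X : R -> T -> state n) (pi : 'I_n -> R) (s : 'I_m -> 'I_n -> R)
    (B : 'I_m -> 'M[R]_n) : Prop := {
  mix_intensity : forall k, intensity_matrix (absorbing_generator (B k));
  mix_nonsingular : forall k, B k \in unitmx;
  mix_phi_measurable : forall k, measurable [set w | phi w = k];
  mix_X_measurable : forall t x, 0 <= t -> measurable [set w | X t w = x];
  mix_right_continuous : right_continuous_paths X;
  mix_init : forall i, P [set w | X 0 w = trans i] = (pi i)%:E;
  mix_init_absorb : P [set w | X 0 w = absorb n] = 0%E;
  mix_s_ge0 : forall k i, 0 <= s k i;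
  mix_s_sum1 : forall i, \sum_k s k i = 1;
  mix_regime : forall k i, 0 < pi i ->
    cond_pr (fine \o P) [set w | X 0 w = trans i] [set w | phi w = k] = s k i;
  mix_markov : forall k i,
    let D := [set w | phi w = k /\ X 0 w = trans i] in
    (0 < P D)%E ->
    markov_jump (cond_pr (fine \o P) D) X (absorbing_generator (B k)) (trans i)
}.

End Conditioning.

(* Main.v *)
(* Conditionally on the regime [k] and on [X_0], the path is Markov with
   generator [Q^(k)].  The forward equation [p' = p Q] identifies the transient
   block of [p u] with [exp (u B^(k))], and shows that a stochastically closed
   set is almost surely never left; so [tau_l > v] and "[X_v] lies outside
   [Gamma_l]" are almost surely the same event.  The Markov property along
   [t <= t_1 <= ... <= t_p] then yields the matrix product, first jointly with
   the cylinder events before [t] and, by a pi-lambda argument, with every event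
   of [sigma (X_s, s < t)].  Summing over [k] gives the defining property of a
   version of the conditional probability, and versions are a.s. unique. *)
Require Import Defs.
From mathcomp Require Import ring measurable_realfun.

Set Implicit Arguments.
Unset Strict Implicit.
Unset Printing Implicit Defensive.

Import Order.TTheory GRing.Theory Num.Theory.
Import numFieldNormedType.Exports.

Local Open Scope classical_set_scope.
Local Open Scope ring_scope.

(** * The matrix exponential *)

Lemma cvg_sum (R : realType) (I T : Type) (F : set_system T) (r : seq I)
    (P : pred I) (f : I -> T -> R) (a : I -> R) : Filter F ->
  (forall i, f i x @[x --> F] --> a i) ->
  \sum_(i <- r | P i) f i x @[x --> F] --> \sum_(i <- r | P i) a i.
Proof. by move=> FF fa; apply: cvg_big => //; exact: add_continuous. Qed.

Section MatrixExponential.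
Context {R : realType} {n : nat}.
Implicit Types A B M : 'M[R]_n.

Lemma exprZ_mx (u : R) B k : (u *: B) ^+ k = u ^+ k *: B ^+ k.
Proof.
elim: k => [|k IH]; first by rewrite !expr0 scale1r.
by rewrite !exprS IH -mulmxE -scalemxAl -scalemxAr scalerA mulmxE.
Qed.

(** The sum of all absolute entries dominates every row sum, so each further factor [B] costs at
    most one factor of it. The exponential series is compared with powers of this constant. *)
Lemma normr_exprmx_le B k i j :
  `|(B ^+ k) i j| <= (\sum_a \sum_b `|B a b|) ^+ k.
Proof.
set K := \sum_a _.
have K0 : 0 <= K by apply: sumr_ge0 => a _; apply: sumr_ge0.
elim: k i j => [|k IH] i j.
  by rewrite !expr0 mxE; case: (i == j); rewrite ?normr1 ?normr0.
rewrite !exprS -mulmxE mxE (le_trans (ler_norm_sum _ _ _))//.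
apply: (@le_trans _ _ (\sum_l `|B i l| * K ^+ k)).
  by apply: ler_sum => l _; rewrite normrM ler_wpM2l.
rewrite -mulr_suml ler_wpM2r ?exprn_ge0//.
by rewrite [leRHS](bigD1 i)//= lerDl sumr_ge0// => a _; exact: sumr_ge0.
Qed.

(** Power series coefficients of an entry of [M *m expm (u *: B)]. Carrying [M] makes the family
    stable under differentiation, which only replaces [M] by [M *m B]. *)
Let coef M B i j (k : nat) : R := (M *m B ^+ k) i j / k`!%:R.

Let coef_diffs M B i j : pseries_diffs (coef M B i j) = coef (M *m B) B i j.
Proof.
apply/funext => k; rewrite /pseries_diffs /coef exprS -mulmxE mulmxA.
rewrite factS natrM invfM mulrCA; congr (_ * _).
by rewrite mulVKf// pnatr_eq0.
Qed.

(** Absolute convergence at every [x], by comparison with [L] times the scalar exponential series at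
    [K] times the absolute value of [x]. *)
Let cvg_pseries_coef M B i j x : cvgn (pseries (coef M B i j) x).
Proof.
set K := \sum_a \sum_b `|B a b|.
set L := \sum_l `|M i l|.
have K0 : 0 <= K by apply: sumr_ge0 => a _; apply: sumr_ge0.
have L0 : 0 <= L by apply: sumr_ge0.
apply: normed_cvg.
apply: (@series_le_cvg _ _ (L *: exp_coeff (K * `|x|))).
- by move=> k; exact: normr_ge0.
- by move=> k /=; rewrite mulr_ge0// exp_coeff_ge0// mulr_ge0.
- move=> k /=; rewrite /coef 2!normrM normfV normr_nat normrX.
  have -> : (L *: exp_coeff (K * `|x|)) k = L * K ^+ k / k`!%:R * `|x| ^+ k.
    by rewrite -[LHS]/(L * ((K * `|x|) ^+ k / k`!%:R)) exprMn; ring.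
  rewrite ler_wpM2r ?exprn_ge0// ler_wpM2r ?invr_ge0//.
  rewrite mxE (le_trans (ler_norm_sum _ _ _))// mulr_suml.
  by apply: ler_sum => l _; rewrite normrM ler_wpM2l// normr_exprmx_le.
- by apply: is_cvg_seriesZ; exact: is_cvg_series_exp_coeff.
Qed.

Let expm_coef B i j u : expm (u *: B) i j = limn (pseries (coef 1%:M B i j) u).
Proof.
rewrite mxE; congr (limn (series _)); apply/funext => k.
rewrite -[RHS]/(coef _ _ _ _ k * u ^+ k) /coef mul1mx exprZ_mx [X in X / _]mxE.
ring.
Qed.

Lemma is_derive_expm B i j (u : R) :
  is_derive u 1 (fun v => expm (v *: B) i j) ((B *m expm (u *: B)) i j).
Proof.
have -> : (fun v => expm (v *: B) i j) =
    (fun v => limn (pseries (coef 1%:M B i j) v)).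
  by apply/funext => v; rewrite expm_coef.
have -> : (B *m expm (u *: B)) i j =
    limn (pseries (pseries_diffs (coef 1%:M B i j)) u).
  (* The differentiated coefficients are [coef B B], a finite combination of those of [expm], so the
     limit passes through the sum over [l]. *)
  rewrite coef_diffs mul1mx mxE; apply/esym/cvg_lim => //.
  have -> : pseries (coef B B i j) u =
      (fun N => \sum_l B i l * pseries (coef 1%:M B l j) u N).
    apply/funext => N; rewrite /pseries /series/=.
    under [RHS]eq_bigr do rewrite mulr_sumr.
    rewrite exchange_big/=; apply: eq_bigr => k _.
    rewrite /coef mxE !mulr_suml; apply: eq_bigr => l _.
    by rewrite mul1mx !mulrA.
  apply: cvg_sum => l; rewrite expm_coef.
  by apply: cvgMr; exact: cvg_pseries_coef.
(* Termwise differentiation asks for convergence at a point farther from 0 than [u]; adding 1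
   provides one. *)
apply: (@pseries_snd_diffs _ _ (`|u| + 1)); rewrite ?coef_diffs //.
by rewrite [ltRHS]ger0_norm ?addr_ge0// ltrDl.
Qed.

Lemma expm0 : expm (0 : 'M[R]_n) = 1%:M.
Proof.
apply/matrixP => i j; rewrite mxE; apply/cvg_lim => //.
apply: cvg_near_cst; exists 1%N => // -[//|N] _.
rewrite /series/= big_mkord big_ord_recl expr0 fact0 divr1 big1 ?addr0// => k _.
by rewrite exprS mul0r mxE mul0r.
Qed.

End MatrixExponential.

(** * Transition functions *)

(** Transition functions are constrained only at nonnegative times, so 0 gets a right limit and no
    derivative. Only [0 < c] is kept, because the sign or vanishing of [df] will be known at all
    positive times. *)
Lemma MVT_from0 (R : realType) (f df : R -> R) (U : R) : 0 < U ->
  (forall u : R, 0 < u -> is_derive u 1 f (df u)) -> f u @[u --> 0^'+] --> f 0 ->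
  exists2 c, 0 < c & f U - f 0 = df c * U.
Proof.
move=> U0 fd f0.
have fc (u : R) : 0 < u -> f v @[v --> u] --> f u.
  move=> u0; apply: differentiable_continuous; apply/derivable1_diffP.
  by have [] := fd u u0.
have [| |c] := @MVT _ f df 0 U U0; rewrite ?in_itv/=.
- by move=> u; rewrite in_itv/= => /andP[/fd].
- by apply/continuous_within_itvP => //; split => //;
    [move=> u; rewrite in_itv/= => /andP[/fc]|apply: cvg_at_left_filter; exact: fc].
- by rewrite subr0 => /andP[c0 _] ->; exists c.
Qed.

Lemma is_derive_sum_fun (R : realType) (I : Type) (r : seq I) (P : pred I)
    (x : R) (h : I -> R -> R) (dh : I -> R) :
  (forall i, is_derive x 1 (h i) (dh i)) ->
  is_derive x 1 (fun v => \sum_(i <- r | P i) h i v) (\sum_(i <- r | P i) dh i).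
Proof.
move=> hd; have -> : (fun v => \sum_(i <- r | P i) h i v) = \sum_(i <- r | P i) h i.
  by apply/funext => v; rewrite fct_sumE.
by elim/big_ind2 : _ => // [|*]; [exact: is_derive_cst|exact: is_deriveD].
Qed.

Section TransitionFunction.
Context {R : realType} {N : nat} {Q : 'M[R]_N} {p : R -> 'M[R]_N}.
Hypothesis pQ : transition_function Q p.

Lemma transition_le1 u x y : 0 <= u -> p u x y <= 1.
Proof.
move=> u0; rewrite -(transition_sum1 pQ u0 x) (bigD1 y)//= lerDl.
by apply: sumr_ge0 => z _; exact: (transition_ge0 pQ).
Qed.

(** The difference quotient at 0 has a finite limit, so multiplying it by [h] sends the increment to
    0. *)
Lemma transition_cvg0 x y : p h x y @[h --> 0^'+] --> p 0 x y.
Proof.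
rewrite (transition_at0 pQ).
have H : h * (h^-1 * (p h x y - (1%:M : 'M[R]_N) x y)) + (1%:M : 'M[R]_N) x y
    @[h --> 0^'+] --> 0 * Q x y + (1%:M : 'M[R]_N) x y.
  apply: cvgD; last exact: cvg_cst.
  apply: cvgM; last exact: (transition_generator pQ).
  by apply: cvg_at_right_filter; exact: cvg_id.
rewrite mul0r add0r in H; apply: cvg_trans H; apply: near_eq_cvg.
near=> h; have h0 : h != 0 by rewrite gt_eqF.
by rewrite mulrA divff// mul1r subrK.
Unshelve. all: by end_near. Qed.

(** The forward equation. By the semigroup law, the difference quotient at [v] is [p v] times the
    one at 0. The choice [v = u] gives the right derivative; [v = u - h] gives the left one, once
    [p] is known to be left continuous. *)
Lemma transition_is_derive (u : R) x y : 0 < u ->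
  is_derive u 1 (fun v => p v x y) ((p u *m Q) x y).
Proof.
move=> u0.
have incr v h : 0 <= v -> 0 < h -> h^-1 * (p (v + h) x y - p v x y) =
    \sum_z p v x z * (h^-1 * (p h z y - (1%:M : 'M[R]_N) z y)).
  move=> v0 h0; rewrite (transition_semigroup pQ v0 (ltW h0)) -{2}[p v]mulmx1.
  rewrite !mxE -sumrB mulr_sumr; apply: eq_bigr => z _; ring.
(* Here [p u - p (u - h)] is [p (u - h)] times [p h - 1]. The entries of [p (u - h)] lie between 0
   and 1, so the error is at most the absolute sum of a column of [p h - 1]. *)
have leftc z : p (u - h) x z @[h --> 0^'+] --> p u x z.
  have : \sum_w `|p h w z - (1%:M : 'M[R]_N) w z| @[h --> 0^'+] --> (0 : R).
    rewrite -[X in _ --> X](_ :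
      \sum_(w < N) `|(1%:M : 'M[R]_N) w z - (1%:M : 'M[R]_N) w z| = 0).
      apply: cvg_sum => w; apply: cvg_norm; apply: cvgB; last exact: cvg_cst.
      by have := @transition_cvg0 w z; rewrite (transition_at0 pQ).
    by rewrite big1 // => w _; rewrite subrr normr0.
  move=> /cvgrPdist_le H; apply/cvgrPdist_le => e e0.
  near=> h.
  have h0 : 0 < h by [].
  have hu : 0 <= u - h by rewrite subr_ge0; near: h; exact: nbhs_right_le.
  have := near (H _ e0) h; rewrite sub0r normrN => /(_ _) He.
  apply: le_trans (He _) => //.
  rewrite [leRHS]ger0_norm ?sumr_ge0//.
  rewrite -{1}(subrK h u) (transition_semigroup pQ hu (ltW h0)).
  rewrite -[p (u - h) in X in _ - X]mulmx1.
  rewrite !mxE -sumrB (le_trans (ler_norm_sum _ _ _))//.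
  apply: ler_sum => w _; rewrite -mulrBr normrM ler_piMl//.
  by rewrite ger0_norm ?transition_le1// (transition_ge0 pQ).
have lim : h^-1 *: (p (h *: 1 + u) x y - p u x y) @[h --> 0^'] -->
    (p u *m Q) x y.
  rewrite mxE; apply: (@cvg_at_right_left_dnbhs _ R^o).
    have H : \sum_z p u x z * (h^-1 * (p h z y - (1%:M : 'M[R]_N) z y))
        @[h --> 0^'+] --> \sum_z p u x z * Q z y.
      by apply: cvg_sum => z; apply: cvgMr; exact: (transition_generator pQ).
    apply: cvg_trans H; apply: near_eq_cvg; near=> h.
    have h0 : 0 < h by [].
    by rewrite -(incr _ _ (ltW u0) h0) [h *: 1]mulr1 [h + u]addrC.
  apply/cvg_at_leftNP; rewrite oppr0.
  have H : \sum_z p (u - h) x z * (h^-1 * (p h z y - (1%:M : 'M[R]_N) z y))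
      @[h --> 0^'+] --> \sum_z p u x z * Q z y.
    apply: cvg_sum => z; apply: cvgM; first exact: leftc.
    exact: (transition_generator pQ).
  apply: cvg_trans H; apply: near_eq_cvg; near=> k.
  have k0 : 0 < k by [].
  have ku : 0 <= u - k by rewrite subr_ge0; near: k; exact: nbhs_right_le.
  rewrite -(incr _ _ ku k0) subrK /= [- k *: 1]mulr1 [- k + u]addrC invrN.
  by rewrite /GRing.scale/= mulNr -mulrN opprB.
apply: DeriveDef; first by apply/cvg_ex; exists ((p u *m Q) x y); exact: lim.
exact: cvg_lim lim.
Unshelve. all: by end_near. Qed.

Lemma transition_closed (G : {set 'I_N}) : intensity_matrix Q ->
  (forall x y, x \in G -> y \notin G -> Q x y = 0) ->
  forall u x y, 0 <= u -> x \in G -> y \notin G -> p u x y = 0.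
Proof.
(* The mass [f u] outside [G] starts at 0 and has derivative
   [\sum_(w \notin G) p u x w * (- \sum_(z in G) Q w z) <= 0]. *)
move=> [Q0 Qsum] QG u x y u0 xG yG.
pose f v := \sum_(z | z \notin G) p v x z.
have f_ge0 v : 0 <= v -> 0 <= f v.
  by move=> v0; apply: sumr_ge0 => z _; exact: (transition_ge0 pQ).
suff fu : f u <= 0.
  apply/eqP; rewrite eq_le (transition_ge0 pQ)// andbT (le_trans _ fu)//.
  rewrite /f (bigD1 y)//= lerDl sumr_ge0// => z _; exact: (transition_ge0 pQ).
have f0 : f 0 = 0.
  rewrite /f (transition_at0 pQ) big1// => z zG; rewrite mxE.
  by case: eqP zG => // <-; rewrite xG.
move: u0; rewrite le_eqVlt => /predU1P[<-|u0]; first by rewrite f0.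
pose df v := \sum_(z | z \notin G) (p v *m Q) x z.
have [||c c0] := @MVT_from0 _ f df _ u0.
- by move=> v v0; apply: is_derive_sum_fun => z; exact: transition_is_derive.
- by apply: cvg_sum => z; exact: transition_cvg0.
rewrite f0 subr0 => ->; rewrite mulr_le0_ge0 ?(ltW u0)// /df.
under eq_bigr do rewrite mxE.
rewrite exchange_big/= sumr_le0// => w _; rewrite -mulr_sumr.
(* Rates leaving [G] vanish. From outside [G], the zero row sum trades the rates within the
   complement for minus the rates into [G], which are off-diagonal. *)
have [wG|wG] := boolP (w \in G).
  by rewrite big1 ?mulr0// => z zG; rewrite QG.
rewrite mulr_ge0_le0 ?(transition_ge0 pQ) ?(ltW c0)//.
have /eqP := Qsum w; rewrite (bigID (fun z => z \in G))/= addrC addr_eq0 => /eqP->.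
rewrite oppr_le0 sumr_ge0// => z zG; apply: Q0.
by apply: contraNneq wG => ->.
Qed.

End TransitionFunction.

(* The transient block of [p v], times [expm ((u - v) B)], is constant in [v]. *)
Lemma transition_transient (R : realType) n (B : 'M[R]_n) (p : R -> 'M[R]_(n + 1)) :
  transition_function (absorbing_generator B) p ->
  forall u i j, 0 <= u -> p u (trans i) (trans j) = expm (u *: B) i j.
Proof.
move=> pQ u i j; rewrite le_eqVlt => /predU1P[<-|u0].
  by rewrite scale0r expm0 (transition_at0 pQ) !mxE (inj_eq (@lshift_inj _ _)).
pose E v := expm ((u - v) *: B).
pose f v := \sum_l p v (trans i) (trans l) * E v l j.
have dE (v : R) l : is_derive v 1 (fun v => E v l j) (- (B *m E v) l j).
  have -> : - (B *m E v) l j = (B *m E v) l j * (- 1) by rewrite mulrN1.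
  apply: (@is_derive1_comp _ (fun v => expm (v *: B) l j) (fun v => u - v)).
    exact: is_derive_expm.
  have := @is_deriveB R R R (cst u) id v 1 0 1 (is_derive_cst _ _ _) (is_derive_id _ _).
  by rewrite sub0r.
have [||c c0] := @MVT_from0 _ f (cst 0) u u0.
- move=> v v0.
  have -> : cst 0 v = \sum_l (p v (trans i) (trans l) *: - (B *m E v) l j +
      E v l j *: (p v *m absorbing_generator B) (trans i) (trans l)).
    rewrite big_split/=.
    have -> : \sum_l E v l j *: (p v *m absorbing_generator B) (trans i) (trans l) =
       \sum_l \sum_a p v (trans i) (trans a) * B a l * E v l j.
      apply: eq_bigr => l _; rewrite /GRing.scale/= mulrC mxE big_split_ord/=.
      (* The lower left block of the generator is zero, so only the transient block of [p]
         survives. *)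
      rewrite [X in _ + X]big1 ?addr0.
        rewrite mulr_suml; apply: eq_bigr => a _.
        by rewrite /absorbing_generator /trans block_mxEul.
      by move=> a _; rewrite /absorbing_generator /trans block_mxEdl mxE mulr0.
    rewrite exchange_big/= -big_split/= big1// => a _.
    rewrite mxE /GRing.scale/= mulrN mulr_sumr addrC -sumrB big1// => l _.
    by rewrite mulrA subrr.
  apply: is_derive_sum_fun => l.
  exact: (is_deriveM (transition_is_derive pQ _ _ v0) (dE v l)).
- apply: cvg_sum => l; apply: cvgM; first exact: (transition_cvg0 pQ).
  apply: cvg_at_right_filter; apply: differentiable_continuous.
  by apply/derivable1_diffP; have [] := dE 0 l.
(* At [v = u] the exponential is the identity, at [v = 0] the factor [p] is: the endpoint values of
   [f] are the two sides of the claim. *)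
rewrite mul0r => /eqP; rewrite subr_eq0 /f /E => /eqP.
under eq_bigr do rewrite subrr scale0r expm0 mxE mulr_natr.
rewrite (transition_at0 pQ).
under [RHS]eq_bigr do rewrite subr0 mxE (inj_eq (@lshift_inj _ _)) mulr_natl.
rewrite (bigD1 j)//= eqxx big1 ?addr0.
  rewrite (bigD1 i)//= eqxx big1 ?addr0// => l /negPf li.
  by rewrite eq_sym li.
by move=> l /negPf ->.
Qed.

(** * Finite-dimensional distributions of the mixture *)

Section RealValuedProbability.
Context {R : realType} {d : measure_display} {T : measurableType d}.
Variable P : probability T R.
Local Notation pr A := (fine (P A)).

Lemma probability_fineK A : measurable A -> (pr A)%:E = P A.
Proof. by move=> mA; rewrite fineK// fin_num_measure. Qed.

Lemma fine_probability_ge0 A : 0 <= pr A.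
Proof. exact: fine_ge0. Qed.

Lemma fine_probability_le A B : measurable A -> measurable B -> A `<=` B ->
  pr A <= pr B.
Proof.
move=> mA mB AB; rewrite fine_le ?fin_num_measure//.
by rewrite le_measure ?inE.
Qed.

Lemma fine_probability_sub0 A B : measurable A -> measurable B -> A `<=` B ->
  pr B = 0 -> pr A = 0.
Proof.
move=> mA mB AB B0; apply/eqP.
by rewrite eq_le fine_probability_ge0 -B0 fine_probability_le.
Qed.

Lemma fine_probability_partition N (f : T -> 'I_N) A :
  (forall x, measurable [set w | f w = x]) -> measurable A ->
  pr A = \sum_x pr (A `&` [set w | f w = x]).
Proof.
move=> mf mA.
have mAf x : measurable (A `&` [set w | f w = x]) by exact: measurableI.
have {1}-> : A = \big[setU/set0]_(x < N) (A `&` [set w | f w = x]).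
  rewrite -bigcup_seq; apply/seteqP; split => [w Aw|w].
  - by exists (f w) => //=; rewrite mem_index_enum.
  - by case=> x _ [].
rewrite measure_bigsetU_ord//.
  rewrite (eq_bigr (fun x => (pr (A `&` [set w | f w = x]))%:E)) ?sumEFin//.
  by move=> x _; exact/esym/probability_fineK.
by move=> x y _ _ [w [[_ /= <-] [_ /= <-]]].
Qed.

End RealValuedProbability.

(** * Events that fix or restrict the state at finitely many times *)

Lemma stateP n (z : state n) : z = absorb n \/ exists i, z = trans i.
Proof.
case: (split_ordP z) => i ->; [by right; exists i|left].
by rewrite (ord1 i).
Qed.

Definition cylinder (R : realType) (T : Type) (S : eqType) (X : R -> T -> S)
    (C : seq (R * S)) : set T :=
  [set w | forall q, q \in C -> X q.1 w = q.2].

(** For stochastically closed sets and nonnegative times this is, up to a null event, the event that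
    every entry time exceeds the time paired with its set. *)
Definition avoids (R : realType) (T : Type) N (X : R -> T -> 'I_N)
    (r : seq (R * {set 'I_N})) : set T :=
  [set w | forall e, e \in r -> X e.1 w \notin e.2].

Lemma mul_outside_mx (R : realType) n q (G : {set state n}) (V : 'M[R]_(n, q)) a b :
  (outside_mx G *m V) a b = (trans a \notin G)%:R * V a b.
Proof. by rewrite /outside_mx mul_diag_mx !mxE. Qed.

(** The ordered product of the theorem in recursive form, [u] being the time already reached. *)
Fixpoint avoidance_mx (R : realType) n (B : 'M[R]_n) (u : R)
    (r : seq (R * {set state n})) : 'M[R]_n :=
  if r is e :: r' then
    expm ((e.1 - u) *: B) *m outside_mx e.2 *m avoidance_mx B e.1 r'
  else 1%:M.

Section MixtureChain.
Context {R : realType} {d : measure_display} {T : measurableType d}.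
Context {P : probability T R} {n m : nat} {phi : T -> 'I_m}.
Variables (X : R -> T -> state n) (pi0 : 'I_n -> R) (s : 'I_m -> 'I_n -> R).
Variables (B : 'I_m -> 'M[R]_n) (hX : mixture_process P phi X pi0 s B).
Local Notation pr A := (fine (P A)).

Lemma measurable_cylinder C : (forall q, q \in C -> 0 <= q.1) ->
  measurable (cylinder X C).
Proof.
elim: C => [|q C IH] HC.
  by rewrite (_ : cylinder X [::] = setT)//; apply/seteqP; split.
rewrite (_ : cylinder X (q :: C) = [set w | X q.1 w = q.2] `&` cylinder X C).
  apply: measurableI.
    by apply: (mix_X_measurable hX); apply: HC; rewrite mem_head.
  by apply: IH => q' q'C; apply: HC; rewrite in_cons q'C orbT.
apply/seteqP; split => [w H|w [/= H1 H2] q'].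
  by split => [/=|q' q'C]; apply: H; rewrite in_cons ?eqxx ?q'C ?orbT.
by rewrite in_cons => /predU1P[->|/H2].
Qed.

Lemma measurable_notin u (G : {set state n}) : 0 <= u ->
  measurable [set w | X u w \notin G].
Proof.
move=> u0.
rewrite (_ : [set _ | _] = \big[setU/set0]_(x < n + 1 | x \notin G) [set w | X u w = x]).
  by apply: bigsetU_measurable => x _; exact: (mix_X_measurable hX).
rewrite -bigcup_seq_cond; apply/seteqP; split => [w /= XG|w].
  by exists (X u w) => //=; rewrite mem_index_enum.
by case=> x /= /andP[_ xG] ->.
Qed.

Lemma measurable_in u (G : {set state n}) : 0 <= u ->
  measurable [set w | X u w \in G].
Proof.
move=> u0; rewrite (_ : [set _ | _] = ~` [set w | X u w \notin G]).
  by apply: measurableC; exact: measurable_notin.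
by apply/seteqP; split => w /=; [move=> ->|move/negP; rewrite negbK].
Qed.

Lemma measurable_avoids r : (forall e, e \in r -> 0 <= e.1) ->
  measurable (avoids X r).
Proof.
elim: r => [|q C IH] HC.
  by rewrite (_ : avoids X [::] = setT)//; apply/seteqP; split.
rewrite (_ : avoids X (q :: C) = [set w | X q.1 w \notin q.2] `&` avoids X C).
  apply: measurableI.
    by apply: measurable_notin; apply: HC; rewrite mem_head.
  by apply: IH => q' q'C; apply: HC; rewrite in_cons q'C orbT.
apply/seteqP; split => [w H|w [/= H1 H2] q'].
  by split => [/=|q' q'C]; apply: H; rewrite in_cons ?eqxx ?q'C ?orbT.
by rewrite in_cons => /predU1P[->|/H2].
Qed.

Let start k i : set T := [set w | phi w = k /\ X 0 w = trans i].

Let measurable_start k i : measurable (start k i).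
Proof.
apply: (measurableI [set w | phi w = k]); first exact: (mix_phi_measurable hX).
by apply: (mix_X_measurable hX).
Qed.

(** The Markov property with denominators cleared: as a product identity it also holds for null
    cylinders, so later sums over states need no positivity. *)
Lemma mixture_markov k i : (0 < P (start k i))%E ->
  exists2 p, transition_function (absorbing_generator (B k)) p &
  forall (C : seq (R * state n)) (u v : R) (x y : state n),
    (u, x) \in C -> (forall q, q \in C -> 0 <= q.1 <= u) -> 0 <= v ->
    pr (start k i `&` cylinder X C `&` [set w | X (u + v) w = y]) =
    pr (start k i `&` cylinder X C) * p v x y.
Proof.
move=> D0; have [_ [p pQ pM]] := mix_markov hX D0; exists p => // C u v x y uC HC v0.
have /andP[u0 _] := HC _ uC.
have mC : measurable (cylinder X C).
  by apply: measurable_cylinder => q /HC/andP[].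
have mS := measurable_start k i.
have prS : 0 < pr (start k i) by rewrite -lte_fin probability_fineK.
have [C0|CN0] := eqVneq (pr (start k i `&` cylinder X C)) 0.
  rewrite C0 mul0r.
  apply: (@fine_probability_sub0 _ _ _ _ _ (start k i `&` cylinder X C)) => //.
  - apply: measurableI; first exact: measurableI.
    by apply: (mix_X_measurable hX); rewrite addr_ge0.
  - exact: measurableI.
(* [C] serves as the list of past observations; as it contains [(u, x)], the conditioning event is
   the cylinder itself. *)
have := pM u v x y C u0 v0 HC.
rewrite (_ : [set w | X u w = x /\ _] = cylinder X C); last first.
  apply/seteqP; split=> [w []//|w Cw]; split => //; exact: (Cw _ uC).
rewrite /cond_pr -/(start k i) /= ![_ `&` start k i]setIC => /(_ _)/esym -> //.
  rewrite setIA.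
  rewrite [start k i `&` _ `&` cylinder X C]setIAC.
  field.
  by rewrite CN0 gt_eqF.
by rewrite divr_gt0// lt_neqAle eq_sym CN0 fine_probability_ge0.
Qed.

(** The start events exhaust the space up to the null event that [X] starts in the absorbing state,
    and those of probability 0 contribute nothing. *)
Lemma fine_probability_start A : measurable A ->
  (forall k i, (0 < P (start k i))%E -> pr (start k i `&` A) = 0) ->
  pr A = 0.
Proof.
move=> mA H; rewrite (fine_probability_partition P (mix_phi_measurable hX) mA).
rewrite big1// => k _.
have mk := mix_phi_measurable hX k.
have m0 x : measurable [set w | X 0 w = x] by exact: (mix_X_measurable hX).
rewrite (fine_probability_partition P m0 (measurableI _ _ mA mk)).
rewrite big1// => z _.
have [z0|[i ->]] := stateP z.
  apply: (@fine_probability_sub0 _ _ _ _ _ [set w | X 0 w = z]) => //.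
  - by apply: measurableI => //; exact: measurableI.
  - by rewrite z0 (mix_init_absorb hX).
have -> : A `&` [set w | phi w = k] `&` [set w | X 0 w = trans i] = start k i `&` A.
  by apply/seteqP; split => [w [[? ?] ?]|w [[? ?] ?]].
have := measure_ge0 P (start k i); rewrite le_eqVlt => /predU1P[S0|]; last exact: H.
apply: (@fine_probability_sub0 _ _ _ _ _ (start k i)) => //.
- exact: measurableI.
- by rewrite -S0.
Qed.

(** The transition function supplied by [mixture_markov] may depend on the initial state, but its
    transient block is always [expm (v *: B k)]. Summing over initial states therefore keeps the
    same factor. *)
Lemma mixture_markov_transient k (C : seq (R * state n)) (u v : R) i j :
  (u, trans i) \in C -> (forall q, q \in C -> 0 <= q.1 <= u) -> 0 <= v ->
  pr ([set w | phi w = k] `&` cylinder X C `&` [set w | X (u + v) w = trans j]) =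
  pr ([set w | phi w = k] `&` cylinder X C) * expm (v *: B k) i j.
Proof.
move=> uC HC v0.
have /andP[u0 _] := HC _ uC.
have mC : measurable (cylinder X C).
  by apply: measurable_cylinder => q /HC/andP[].
have mk := mix_phi_measurable hX k.
have m0 x : measurable [set w | X 0 w = x] by exact: (mix_X_measurable hX).
have mv x : measurable [set w | X (u + v) w = x].
  by apply: (mix_X_measurable hX); rewrite addr_ge0.
have mkC := measurableI _ _ mk mC.
rewrite (fine_probability_partition P m0 (measurableI _ _ mkC (mv _))).
rewrite (fine_probability_partition P m0 mkC) mulr_suml.
apply: eq_bigr => z _.
have [z0|[a ->]] := stateP z.
  have Z A : measurable A -> pr (A `&` [set w | X 0 w = z]) = 0.
    move=> mA; apply: (@fine_probability_sub0 _ _ _ _ _ [set w | X 0 w = z]) => //.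
      exact: measurableI.
    by rewrite z0 (mix_init_absorb hX).
  by rewrite !Z ?mul0r//; exact: measurableI.
have -> : [set w | phi w = k] `&` cylinder X C `&` [set w | X (u + v) w = trans j]
    `&` [set w | X 0 w = trans a] =
    start k a `&` cylinder X C `&` [set w | X (u + v) w = trans j].
  by apply/seteqP; split => [w [[[? ?] ?] ?]|w [[[? ?] ?] ?]].
have -> : [set w | phi w = k] `&` cylinder X C `&` [set w | X 0 w = trans a] =
    start k a `&` cylinder X C.
  by apply/seteqP; split => [w [[? ?] ?]|w [[? ?] ?]].
have := measure_ge0 P (start k a); rewrite le_eqVlt => /predU1P[S0|S0].
  have Z A : measurable A -> pr (start k a `&` A) = 0.
    move=> mA; apply: (@fine_probability_sub0 _ _ _ _ _ (start k a)) => //.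
      exact: measurableI.
    by rewrite -S0.
  by rewrite -setIA !Z ?mul0r//; exact: measurableI.
have [p pQ pM] := mixture_markov S0.
by rewrite (pM _ _ _ _ _ uC)// (transition_transient pQ).
Qed.

(** Induction on [r], for all cylinders at once: split on the state at the next time, apply the
    one-step formula, and add that state to the cylinder. *)
Lemma mixture_avoidance k (C : seq (R * state n)) (u : R) i
    (r : seq (R * {set state n})) :
  (u, trans i) \in C -> (forall q, q \in C -> 0 <= q.1 <= u) ->
  path <=%R u [seq e.1 | e <- r] -> (forall e, e \in r -> absorb n \in e.2) ->
  pr ([set w | phi w = k] `&` cylinder X C `&` avoids X r) =
  pr ([set w | phi w = k] `&` cylinder X C) *
  (avoidance_mx (B k) u r *m const_mx 1 : 'cV_n) i 0.
Proof.
have mk := mix_phi_measurable hX k.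
elim: r u i C => [|e r IH] u i C uC HC.
  rewrite /= mul1mx mxE mulr1 (_ : avoids X [::] = setT) ?setIT//.
  by apply/seteqP; split.
have /andP[u0 _] := HC _ uC.
rewrite /= => /andP[ue er] HG.
have e0 : 0 <= e.1 by exact: le_trans ue.
have r0 e' : e' \in r -> 0 <= e'.1.
  move=> e'r; have := er; rewrite path_sortedE; last exact: le_trans.
  move=> /andP[/allP/(_ e'.1) + _]; rewrite map_f// => /(_ isT).
  exact: le_trans.
have mC : measurable (cylinder X C).
  by apply: measurable_cylinder => q /HC/andP[].
have me x : measurable [set w | X e.1 w = x] by exact: (mix_X_measurable hX).
have mr : measurable (avoids X r) by exact: measurable_avoids.
have mer : measurable (avoids X (e :: r)).
  by apply: measurable_avoids => e'; rewrite in_cons => /predU1P[->//|/r0].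
have mkC := measurableI _ _ mk mC.
rewrite (fine_probability_partition P me (measurableI _ _ mkC mer)).
(* The absorbing state lies in every set of the list, so only transient states remain and [n] by [n]
   matrices suffice. *)
rewrite big_split_ord/= [X in _ + X]big1 ?addr0; last first.
  move=> a _; rewrite (_ : _ `&` _ = set0) ?measure0//.
  apply/seteqP; split=> // w [[_ /(_ e)]]; rewrite mem_head => /(_ isT) /= + Xe.
  by rewrite Xe (ord1 a) HG ?mem_head.
rewrite -!mulmxA mxE mulr_sumr; apply: eq_bigr => a _.
rewrite mul_outside_mx.
have [aG|aG] := boolP (trans a \in e.2).
  rewrite mul0r !mulr0 (_ : _ `&` _ = set0) ?measure0//.
  apply/seteqP; split=> // w [[_ /(_ e)]]; rewrite mem_head => /(_ isT) /= + Xe.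
  by rewrite Xe -/(trans a) aG.
rewrite mul1r mulrA -(mixture_markov_transient _ _ uC)// ?subr_ge0//.
rewrite (addrC u) subrK.
(* The observation at [e.1] becomes the new present for the induction hypothesis. *)
pose C' := (e.1, trans a) :: C.
have CE : [set w | phi w = k] `&` cylinder X C `&` [set w | X e.1 w = trans a] =
    [set w | phi w = k] `&` cylinder X C'.
  apply/seteqP; split => [w [[/= ? H] H']|w [/= ? H]].
    by split => // q; rewrite in_cons => /predU1P[->|/H].
  split; [split => // q qC|]; [apply: H|apply: (H (e.1, trans a))].
    by rewrite in_cons qC orbT.
  by rewrite mem_head.
rewrite CE -(IH e.1 a C').
- congr (fine (P _)); rewrite -CE.
  apply/seteqP; split => [w [[H1 H2] H3]|w [[H1 H3] H2]].
    by split=> // e' e'r; apply: H2; rewrite in_cons e'r orbT.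
  split=> //; split=> // e'; rewrite in_cons => /predU1P[->|/H2//].
  by move: H3 => /= ->.
- by rewrite mem_head.
- move=> q; rewrite in_cons => /predU1P[->/=|/HC/andP[-> qu]]; first by rewrite e0 lexx.
  exact: le_trans ue.
- by [].
- by move=> e' e'r; apply: HG; rewrite in_cons e'r orbT.
Qed.

End MixtureChain.

(** * Conditional probabilities *)

Section SigmaFields.
Context {R : realType} {d : measure_display} {T : measurableType d}.
Variable P : probability T R.
Local Notation pr A := (fine (P A)).

(** The pi-lambda argument: the events satisfying the identity are stable under proper differences
    by additivity, and under increasing unions by continuity from below. *)
Lemma fine_probability_dynkin (G : set (set T)) (A A' : set T) (a : R) :
  G `<=` measurable -> setI_closed G -> G setT ->
  measurable A -> measurable A' ->
  (forall S, G S -> pr (A `&` S) = a * pr (A' `&` S)) ->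
  forall S, <<s G >> S -> pr (A `&` S) = a * pr (A' `&` S).
Proof.
move=> Gm GI GT mA mA' GA.
suff H : <<s G >> `<=` [set S | measurable S /\ pr (A `&` S) = a * pr (A' `&` S)].
  by move=> S /H[].
apply: lambda_system_subset => //; last first.
  by move=> S GS; split; [exact: Gm|exact: GA].
split => //; first by split=> //; exact: GA.
- move=> S1 S2 S21 [m1 E1] [m2 E2]; split; first exact: measurableD.
  have H C : measurable C -> pr (C `&` (S1 `\` S2)) = pr (C `&` S1) - pr (C `&` S2).
    move=> mC.
    have mC1 := measurableI _ _ mC m1; have mC2 := measurableI _ _ mC m2.
    rewrite (_ : C `&` (S1 `\` S2) = (C `&` S1) `\` (C `&` S2)); last first.
      apply/seteqP; split => [w [Cw [S1w nS2]]|w [[Cw S1w] nC]].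
        by split => // -[_ /nS2].
      by split=> //; split=> // S2w; apply: nC.
    rewrite measureD//; last by rewrite ltey_eq fin_num_measure.
    rewrite (_ : C `&` S1 `&` (C `&` S2) = C `&` S2) ?fineB ?fin_num_measure//.
    apply/seteqP; split => [w [[? ?] [? ?]]|w [? ?]] //.
    by split => //; split=> //; exact: S21.
  by rewrite !H// E1 E2 mulrBr.
- move=> F ndF HF; have mF i : measurable (F i) by have [] := HF i.
  have mU : measurable (\bigcup_i F i) by exact: bigcup_measurable.
  split => //.
  have H C : measurable C -> pr (C `&` F i) @[i --> \oo] --> pr (C `&` \bigcup_i F i).
    move=> mC; apply: fine_cvg; rewrite probability_fineK; last exact: measurableI.
    rewrite setI_bigcupr.
    apply: (nondecreasing_cvg_mu (F := fun i => C `&` F i)).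
    - by move=> i; exact: measurableI.
    - by apply: bigcup_measurable => i _; exact: measurableI.
    - by move=> i j ij; apply/subsetPset; apply: setIS; apply/subsetPset; exact: ndF.
  have hA := H _ mA.
  have hA' : a * pr (A' `&` F i) @[i --> \oo] --> a * pr (A' `&` \bigcup_i F i).
    by apply: cvgMr; exact: H.
  rewrite -(cvg_lim _ hA)// -(cvg_lim _ hA')//; congr (lim (_ @ \oo)).
  by apply/funext => i; have [] := HF i.
Qed.

(** Since [f] is measurable for [F], the events where it is positive and where it is negative belong
    to [F]. On each, a zero integral with constant sign forces [f] to vanish almost everywhere. *)
Lemma ae_eq0_sub_sigma (F : set (set T)) (f : T -> R) :
  sigma_algebra setT F -> F `<=` measurable ->
  (forall Y, measurable Y -> F (f @^-1` Y)) ->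
  P.-integrable setT (EFin \o f) ->
  (forall S, F S -> (\int[P]_(w in S) (f w)%:E = 0)%E) ->
  {ae P, forall w, f w = 0}.
Proof.
move=> sF Fm fF fi f0.
have mf : measurable_fun setT f by apply/measurable_EFinP; exact: measurable_int fi.
have H S : F S -> {in S, forall w, 0 <= f w} \/ {in S, forall w, f w <= 0} ->
    {ae P, forall w, S w -> f w = 0}.
  move=> FS fS; have mS := Fm _ FS.
  have mfS : measurable_fun S (EFin \o f).
    by apply/measurable_EFinP; exact: measurable_funS mf.
  have fiS : P.-integrable S (EFin \o f) by exact: integrableS fi.
  suff I0 : (\int[P]_(w in S) `|(EFin \o f) w| = 0)%E.
    have [/(_ I0) f_ae _] := ae_eq_integral_abs P mS mfS.
    by apply: filterS f_ae => w fw /fw [].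
  case: fS => fS.
    by rewrite -(f0 _ FS); apply: eq_integral => w wS /=; rewrite ger0_norm// fS.
  rewrite (eq_integral (fun w => - (f w)%:E)%E); last first.
    by move=> w wS /=; rewrite ler0_norm// fS.
  rewrite integralN; first by rewrite (f0 _ FS) oppe0.
  exact: (integrable_add_def mS fiS).
have Fp : F [set w | 0 < f w].
  rewrite (_ : [set _ | _] = f @^-1` `]0, +oo[).
    by apply: fF; exact: measurable_itv.
  by apply/seteqP; split => w /=; rewrite in_itv/= andbT.
have Fn : F [set w | f w < 0].
  rewrite (_ : [set _ | _] = f @^-1` `]-oo, 0[).
    by apply: fF; exact: measurable_itv.
  by apply/seteqP; split => w /=; rewrite in_itv.
have Hp : {ae P, forall w, 0 < f w -> f w = 0}.
  by apply: H => //; left => w; rewrite inE /= => /ltW.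
have Hn : {ae P, forall w, f w < 0 -> f w = 0}.
  by apply: H => //; right => w; rewrite inE /= => /ltW.
apply: filterS2 Hp Hn => w Hp Hn.
by have [/Hn|/Hp|] := ltgtP (f w) 0.
Qed.

(** Uniqueness of versions, in linear form: the difference of the two sides is measurable for [F]
    and integrates to 0 over every event of [F]. *)
Lemma cond_prob_linear (F : set (set T)) (cp : set T -> T -> R)
    (I : finType) (A : set T) (A_ : I -> set T) (a : I -> R) :
  sigma_algebra setT F -> F `<=` measurable -> cond_prob_given P F cp ->
  measurable A -> (forall i, measurable (A_ i)) ->
  (forall S, F S -> pr (A `&` S) = \sum_i a i * pr (A_ i `&` S)) ->
  {ae P, forall w, cp A w = \sum_i a i * cp (A_ i) w}.
Proof.
move=> sF Fm cpP mA mA_ AE.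
pose g w := \sum_i a i * cp (A_ i) w.
(* Measurability for [F] is phrased on the sigma-field generated by [F], so that sums and products
   stay measurable; this sigma-field is [F] itself. *)
have mF (B : set T) : measurable B ->
    measurable_fun (setT : set (g_sigma_algebraType F)) (cp B).
  move=> mB _ Y mY; rewrite setTI; apply: sub_sigma_algebra.
  by have [+ _ _] := cpP _ mB; exact.
have ci B : measurable B -> P.-integrable setT (EFin \o cp B).
  by move=> mB; have [] := cpP _ mB.
have cE B S : measurable B -> F S -> (\int[P]_(w in S) (cp B w)%:E = (pr (B `&` S))%:E)%E.
  move=> mB FS; have [_ _ ->//] := cpP _ mB.
  by rewrite probability_fineK//; apply: measurableI => //; exact: Fm.
have gi : P.-integrable setT (EFin \o g).
  rewrite (_ : _ \o _ = (fun w => \sum_i ((a i)%:E * (cp (A_ i) w)%:E)%E)); last first.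
    by apply/funext => w /=; rewrite -sumEFin.
  by apply: integrable_sum => // i _; apply: integrableZl => //; exact: ci.
suff : {ae P, forall w, (cp A \- g) w = 0}.
  by apply: filterS => w /= /eqP; rewrite subr_eq0 => /eqP.
apply: (ae_eq0_sub_sigma sF) => //.
- move=> Y mY.
  have : measurable_fun (setT : set (g_sigma_algebraType F)) (cp A \- g).
    apply: measurable_funB; first exact: mF.
    by apply: measurable_sum => i; apply: measurable_funM => //; exact: mF.
  move=> /(_ measurableT _ mY); rewrite setTI.
  by rewrite /measurable/= sigma_algebra_id.
- rewrite (_ : _ \o _ = ((EFin \o cp A) \- (EFin \o g))%E)//.
  by apply: integrableB => //; exact: ci.
- move=> S FS; have mS := Fm _ FS.
  rewrite (eq_integral (fun w => (cp A w)%:E - (g w)%:E)%E)//.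
  rewrite integralB_EFin//; last 2 first.
  - by apply: integrableS (ci _ mA).
  - exact: integrableS gi.
  rewrite cE// [X in (_ - X)%E](_ : _ = (\sum_i a i * pr (A_ i `&` S))%:E).
    by rewrite AE// -EFinB subrr.
  rewrite (eq_integral (fun w => \sum_i ((a i)%:E * (cp (A_ i) w)%:E)%E)); last first.
    by move=> w _; rewrite -sumEFin.
  rewrite integral_sum//; last first.
    by move=> i; apply: integrableZl => //; apply: integrableS (ci _ (mA_ i)).
  rewrite -sumEFin; apply: eq_bigr => i _.
  by rewrite integralZl ?cE//; apply: integrableS (ci _ (mA_ i)).
Qed.

End SigmaFields.

(** * Entry times and the past *)

(** The list under [nth] is headed by [u], so its entry at [l] is the time preceding [v l], with [u]
    before the first. *)
Lemma avoidance_mxE (R : realType) n (B : 'M[R]_n) (u : R) p (v : 'I_p -> R)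
    (G : 'I_p -> {set state n}) :
  avoidance_mx B u [seq (v l, G l) | l : 'I_p] =
  \prod_(l < p) (expm ((v l - nth u (u :: [seq v l | l : 'I_p]) l) *: B)
                  *m outside_mx (G l)).
Proof.
rewrite /image_mem; elim: p u v G => [|p IH] u v G.
  by rewrite enum_ord0 big_ord0.
rewrite enum_ordSl !map_cons -[in LHS]map_comp big_ord_recl -mulmxE.
rewrite -[LHS]/(expm ((v ord0 - u) *: B) *m outside_mx (G ord0) *m
  avoidance_mx B (v ord0)
    [seq ((v \o lift ord0) l, (G \o lift ord0) l) | l <- enum 'I_p]).
congr (_ *m _).
rewrite (IH (v ord0) (v \o lift ord0) (G \o lift ord0)).
apply: eq_bigr => l _; rewrite lift0 -[nth u (u :: _) _]/(nth u (v ord0 :: _) l).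
(* The induction hypothesis reads the list with default [v ord0] instead of [u]; the index is in
   range, so both agree. *)
rewrite (set_nth_default (v ord0)); first by rewrite -[in RHS]map_comp.
rewrite -[X in (_ < X)%N]/(size (map v (map (lift ord0) (enum 'I_p)))).+1.
by rewrite 2!size_map size_enum_ord ltnS ltnW.
Qed.

(** Right continuity makes each path locally constant to the right, so rational times before [v],
    together with [v], detect every visit up to [v]. The criterion is countable, hence usable for
    measurability and almost sure statements. *)
Lemma entry_time_gtP (R : realType) (T : Type) N (X : R -> T -> 'I_N)
    (G : {set 'I_N}) (v : R) w :
  right_continuous_paths X -> 0 <= v ->
  (v%:E < entry_time X G w)%E <->
  X v w \notin G /\ forall q : rat, 0 <= (ratr q : R) < v -> X (ratr q) w \notin G.
Proof.
move=> Xrc v0; split => [ve|[Xv Xq]].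
  have notG u : 0 <= u <= v -> X u w \notin G.
    move=> /andP[u0 uv]; apply/negP => uG.
    have : (entry_time X G w <= u%:E)%E by apply: ereal_inf_lbound; exists u.
    by move=> /(lt_le_trans ve); rewrite lte_fin ltNge uv.
  split=> [|q /andP[q0 qv]]; apply: notG; first by rewrite v0 lexx.
  by rewrite q0 ltW.
have notG u : 0 <= u <= v -> X u w \notin G.
  move=> /andP[u0]; rewrite le_eqVlt => /predU1P[->//|uv].
  have [e /= e0 He] := Xrc w u u0.
  (* A rational this close to the right of [u] carries the same state as [u] and still precedes
     [v]. *)
  have /(@rat_in_itvoo R)[q] : u < Num.min v (u + e) by rewrite lt_min uv ltrDl.
  rewrite in_itv/= lt_min => /and3P[uq qv que].
  rewrite -(He (ratr q))//; last first.
    by rewrite /= distrC gtr0_norm ?subr_gt0// ltrBlDl.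
  by apply: Xq; rewrite qv (le_trans u0)// ltW.
(* The path keeps its state for a time [e] after [v], so the infimum is at least [v + e] and the
   inequality is strict. *)
have [e /= e0 He] := Xrc w v v0.
apply: (@lt_le_trans _ _ (v + e)%:E); first by rewrite lte_fin ltrDl.
apply/ereal_infP => _ [u [u0 uG] <-]; rewrite lee_fin leNgt; apply/negP => uve.
have [uv|vu] := leP u v.
  by have := notG u; rewrite u0 uv uG => /(_ isT).
have := He u; rewrite /= distrC gtr0_norm ?subr_gt0// ltrBlDl => /(_ uve vu) E.
by move: Xv; rewrite -E uG.
Qed.

(** A pi-system: concatenating lists intersects the events, and the empty list gives the whole
    space. *)
Definition cylinders_before (R : realType) (T : Type) (S : eqType)
    (X : R -> T -> S) (t : R) : set (set T) :=
  [set A | exists2 C : seq (R * S), (forall q, q \in C -> 0 <= q.1 < t) &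
    A = cylinder X C].

Lemma cylinders_before_setI (R : realType) (T : Type) (S : eqType)
    (X : R -> T -> S) t : setI_closed (cylinders_before X t).
Proof.
move=> _ _ [C HC ->] [D HD ->]; exists (C ++ D).
  by move=> q; rewrite mem_cat => /orP[/HC|/HD].
apply/seteqP; split => [w [wC wD] q|w wCD].
  by rewrite mem_cat => /orP[/wC|/wD].
by split=> q qC; apply: wCD; rewrite mem_cat qC ?orbT.
Qed.

(** There are finitely many states, so any event about [X u] is a finite union of cylinders with a
    single observation. *)
Lemma sigma_before_cylinders (R : realType) (T : Type) N (X : R -> T -> 'I_N) t :
  sigma_before X t `<=` <<s cylinders_before X t >>.
Proof.
apply: smallest_sub; first exact: smallest_sigma_algebra.
move=> _ [u u0 [Y ->]].
have -> : X u @^-1` Y =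
    \big[setU/set0]_(x < N | `[< Y x >]) [set w | X u w = x].
  rewrite -bigcup_seq_cond; apply/seteqP; split => [w /= Yw|w].
    by exists (X u w) => //=; rewrite mem_index_enum; apply/asboolP.
  by case=> x /= /andP[_ /asboolP Yx] ->.
elim/big_ind: _ => [|A1 A2 F1 F2|x _]; first exact: sigma_algebra0.
  rewrite -bigcup2E; apply: sigma_algebra_bigcup => -[|[|i]] //=.
  exact: sigma_algebra0.
apply: sub_sigma_algebra; exists [:: (u, x)].
  by move=> q; rewrite inE => /eqP->.
apply/seteqP; split => [w <- q|w /(_ (u, x))]; first by rewrite inE => /eqP->.
by rewrite mem_head; exact.
Qed.

(** * Measurability of entry times and their reduction to a single time *)

Section MixtureEntry.
Context {R : realType} {d : measure_display} {T : measurableType d}.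
Context {P : probability T R} {n m : nat} {phi : T -> 'I_m}.
Variables (X : R -> T -> state n) (pi0 : 'I_n -> R) (s : 'I_m -> 'I_n -> R).
Variables (B : 'I_m -> 'M[R]_n) (hX : mixture_process P phi X pi0 s B).
Local Notation pr A := (fine (P A)).

Lemma measurable_cylinders_before t S : cylinders_before X t S -> measurable S.
Proof.
by case=> C HC ->; apply: (measurable_cylinder hX) => q /HC/andP[].
Qed.

Lemma measurable_sigma_before t S : sigma_before X t S -> measurable S.
Proof.
move=> /sigma_before_cylinders; apply: smallest_sub; last first.
  exact: measurable_cylinders_before.
by split=> [|A mA|F mF]; [|rewrite setTD; exact: measurableC|exact: bigcupT_measurable].
Qed.

(** Given the regime and the start, each pair of states [x] in [G] and [y] outside it has transition
    probability 0 by [transition_closed]; finitely many pairs cover the event. *)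
Lemma mixture_closed_null G u v : stoch_closed B G -> 0 <= u <= v ->
  P [set w | X u w \in G /\ X v w \notin G] = 0%E.
Proof.
move=> BG /andP[u0 uv]; have v0 := le_trans u0 uv.
have mu x : measurable [set w | X u w = x] by exact: (mix_X_measurable hX).
have mv x : measurable [set w | X v w = x] by exact: (mix_X_measurable hX).
have mA : measurable [set w | X u w \in G /\ X v w \notin G].
  apply: (measurableI [set w | X u w \in G]); first exact: (measurable_in hX).
  exact: (measurable_notin hX).
rewrite -probability_fineK//; congr (_%:E).
apply: (fine_probability_start hX) => // k i D0.
have [p pQ pM] := mixture_markov hX D0.
have mD : measurable [set w | phi w = k /\ X 0 w = trans i].
  apply: (measurableI [set w | phi w = k]); first exact: (mix_phi_measurable hX).
  by apply: (mix_X_measurable hX).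
have mDA := measurableI _ _ mD mA.
rewrite (fine_probability_partition P mu mDA) big1// => x _.
rewrite (fine_probability_partition P mv (measurableI _ _ mDA (mu x))) big1// => y _.
have [/andP[xG yG]|xyG] := boolP ((x \in G) && (y \notin G)); last first.
  rewrite (_ : _ `&` _ = set0) ?measure0//; apply/seteqP; split => // w.
  move=> [[[_ /= [uG vG]] /= ux] /= vy]; move: xyG.
  by rewrite -ux -vy uG vG.
have mC : measurable (cylinder X [:: (u, x)]).
  by apply: (measurable_cylinder hX) => q; rewrite inE => /eqP->.
apply: (@fine_probability_sub0 _ _ _ _ _ ([set w | phi w = k /\ X 0 w = trans i]
    `&` cylinder X [:: (u, x)] `&` [set w | X (u + (v - u)) w = y])).
- by apply: measurableI => //; exact: measurableI.
- by apply: measurableI; [exact: measurableI|rewrite addrC subrK].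
- move=> w [[[Dw _] /= ux] /= vy]; split; last by rewrite /= addrC subrK.
  by split=> // q; rewrite inE => /eqP->.
rewrite (pM _ _ _ x)//.
- rewrite (transition_closed pQ (mix_intensity hX k) _ _ xG yG) ?mulr0//.
    by move=> a b; exact: BG.
  by rewrite subr_ge0.
- by rewrite mem_head.
- by move=> q; rewrite inE => /eqP-> /=; rewrite u0 lexx.
- by rewrite subr_ge0.
Qed.

Lemma measurable_entry_time_gt G v : 0 <= v ->
  measurable [set w | (v%:E < entry_time X G w)%E].
Proof.
move=> v0.
(* Rationals are enumerated by [unpickle]; an index that codes no rational imposes no condition. *)
rewrite (_ : [set _ | _] = [set w | X v w \notin G] `&` \bigcap_i
    [set w | if unpickle i is Some q then
               0 <= (ratr q : R) < v -> X (ratr q) w \notin G else True]).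
  apply: measurableI; first exact: (measurable_notin hX).
  apply: bigcapT_measurable => i; case: (unpickle i) => [q|]; last first.
    by rewrite (_ : [set _ | _] = setT)//; apply/seteqP; split.
  have [/[dup] /andP[q0 _] qv|qv] := boolP (0 <= (ratr q : R) < v).
    rewrite (_ : [set _ | _] = [set w | X (ratr q) w \notin G]).
      exact: (measurable_notin hX).
    by apply/seteqP; split => w //=; exact.
  by rewrite (_ : [set _ | _] = setT)//; apply/seteqP; split.
apply/seteqP; split => w /=.
  move=> /(entry_time_gtP _ _ (mix_right_continuous hX) v0)[Xv Xq]; split => // i _.
  by case: (unpickle i) => [q|//] /=; exact: Xq.
move=> [Xv Xq]; apply/(entry_time_gtP _ _ (mix_right_continuous hX) v0); split => // q.
by have := Xq (pickle q) I; rewrite /= pickleK.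
Qed.

Lemma measurable_entry_times_gt p (G : 'I_p -> {set state n}) (v : 'I_p -> R) :
  (forall l, 0 <= v l) ->
  measurable [set w | forall l, ((v l)%:E < entry_time X (G l) w)%E].
Proof.
move=> v0.
rewrite (_ : [set _ | _] = \bigcap_l [set w | ((v l)%:E < entry_time X (G l) w)%E]).
  by apply: fin_bigcap_measurable => // l _; exact: measurable_entry_time_gt.
by apply/seteqP; split => [w H l _|w H l]; [exact: H|exact: (H l I)].
Qed.

(** For each rational time before [v], being in [G] then and outside at [v] is a null event. Off the
    countable union of these events, the rational criterion holds. *)
Lemma ae_entry_time_gt G v : stoch_closed B G -> 0 <= v ->
  {ae P, forall w, X v w \notin G -> (v%:E < entry_time X G w)%E}.
Proof.
move=> BG v0.
have H i : {ae P, forall w, if unpickle i is Some q then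
    0 <= (ratr q : R) < v -> X v w \notin G -> X (ratr q) w \notin G else True}.
  case: (unpickle i) => [q|]; last exact: filterE.
  have [/[dup] /andP[q0 /ltW qv'] qv|qv] := boolP (0 <= (ratr q : R) < v); last first.
    exact: filterE.
  have := mixture_closed_null BG (_ : 0 <= (ratr q : R) <= v);
  rewrite q0 qv' => /(_ isT) N.
  exists [set w | X (ratr q) w \in G /\ X v w \notin G]; split => //.
    apply: (measurableI [set w | X (ratr q) w \in G]).
      exact: (measurable_in hX).
    exact: (measurable_notin hX).
  move=> w /= nH; apply: contrapT => nN; apply: nH => _ vG; apply/negP => uG.
  exact: nN.
have := ae_foralln H; apply: filterS => w Hw vG.
apply/(entry_time_gtP _ _ (mix_right_continuous hX) v0); split => // q qv.
by have := Hw (pickle q); rewrite pickleK; exact.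
Qed.

End MixtureEntry.

(** * Conditioning on the past *)

Section MixtureConditioning.
Context {R : realType} {d : measure_display} {T : measurableType d}.
Context {P : probability T R} {n m : nat} {phi : T -> 'I_m}.
Variables (X : R -> T -> state n) (pi0 : 'I_n -> R) (s : 'I_m -> 'I_n -> R).
Variables (B : 'I_m -> 'M[R]_n) (hX : mixture_process P phi X pi0 s B).
Local Notation pr A := (fine (P A)).

(** The avoidance factor is the same for every cylinder before [t], so the identity extends to the
    generated sigma-field. *)
Lemma mixture_avoidance_sigma_before k (t : R) j (r : seq (R * {set state n})) S :
  0 <= t -> path <=%R t [seq e.1 | e <- r] ->
  (forall e, e \in r -> absorb n \in e.2) -> sigma_before X t S ->
  pr (([set w | phi w = k] `&` [set w | X t w = trans j] `&` avoids X r) `&` S) =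
  (avoidance_mx (B k) t r *m const_mx 1 : 'cV_n) j 0 *
  pr (([set w | phi w = k] `&` [set w | X t w = trans j]) `&` S).
Proof.
move=> t0 tr rG /sigma_before_cylinders.
have mk := mix_phi_measurable hX k.
have mt : measurable [set w | X t w = trans j] by exact: (mix_X_measurable hX).
have mr : measurable (avoids X r).
  apply: (measurable_avoids hX) => e er; move: tr.
  rewrite path_sortedE; last exact: le_trans.
  by move=> /andP[/allP/(_ e.1) + _]; rewrite map_f// => /(_ isT); exact: le_trans.
move: S; apply: fine_probability_dynkin.
- exact: (measurable_cylinders_before hX).
- exact: cylinders_before_setI.
- by exists [::] => //; apply/seteqP; split.
- by apply: measurableI => //; exact: measurableI.
- exact: measurableI.
move=> _ [C HC ->].
(* The state at [t] joins the cylinder as its latest observation. *)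
have CE : [set w | X t w = trans j] `&` cylinder X C = cylinder X ((t, trans j) :: C).
  apply/seteqP; split => [w [H H'] q|w H].
    by rewrite in_cons => /predU1P[->|/H'].
  split; first by apply: (H (t, trans j)); rewrite mem_head.
  by move=> q qC; apply: H; rewrite in_cons qC orbT.
rewrite setIAC -[_ `&` _ `&` cylinder X C]setIA CE.
rewrite (mixture_avoidance hX k (u := t) (i := j))//.
- exact: mulrC.
- by rewrite mem_head.
- move=> q; rewrite in_cons => /predU1P[->/=|/HC/andP[-> /ltW//]].
  by rewrite t0 lexx.
Qed.

(** The entry time event is contained in the avoidance event, and the difference is null by
    [ae_entry_time_gt]. *)
Lemma fine_probability_entry_times p (G : 'I_p -> {set state n}) (v : 'I_p -> R) :
  (forall l, stoch_closed B (G l)) -> (forall l, 0 <= v l) ->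
  forall C, measurable C ->
  pr ([set w | forall l, ((v l)%:E < entry_time X (G l) w)%E] `&` C) =
  pr (avoids X [seq (v l, G l) | l : 'I_p] `&` C).
Proof.
move=> BG v0 C mC.
set r := [seq _ | l : _].
have mA : measurable [set w | forall l, ((v l)%:E < entry_time X (G l) w)%E].
  exact: (measurable_entry_times_gt hX).
have mr : measurable (avoids X r).
  by apply: (measurable_avoids hX) => e /mapP[l _ ->]; exact: v0.
set A := [set w | forall l, _] in mA *.
have Ar : A `<=` avoids X r.
  move=> w Aw e /mapP[l _ ->] /=.
  by have [/(_ (Aw l))[]] := entry_time_gtP (G l) w (mix_right_continuous hX) (v0 l).
have N : P (avoids X r `\` A) = 0%E.
  apply/negligibleP; first exact: measurableD.
  have : {ae P, forall w, forall l, X (v l) w \notin G l ->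
      ((v l)%:E < entry_time X (G l) w)%E}.
    by apply: filter_forall => l; exact: (ae_entry_time_gt hX).
  apply: negligibleS => w [/= rw nA] H; apply: nA => l; apply: H.
  by apply: (rw (v l, G l)); rewrite /r map_f ?mem_enum.
apply/eqP; rewrite eq_le fine_probability_le ?andTb//; [| | |exact: setSI].
- have -> : avoids X r `&` C = (A `&` C) `|` ((avoids X r `\` A) `&` C).
    by rewrite -setIUl setUDr; congr (_ `&` _); rewrite setDv setD0; apply/esym/setUidPr.
  rewrite measureU0 ?lexx//.
  + exact: measurableI.
  + by apply: measurableI => //; exact: measurableD.
  + apply: (subset_measure0 _ _ _ N); [|exact: measurableD|by move=> w []].
    by apply: measurableI => //; exact: measurableD.
- exact: measurableI.
- exact: measurableI.
Qed.

End MixtureConditioning.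

(** * The product formula for the exit times, and the regime weights summing to the identity *)

Theorem lemma3p17 (R : realType) (d : measure_display) (T : measurableType d)
  (P : probability T R) (n m p : nat)
  (phi : T -> 'I_m) (X : R -> T -> state n)
  (pi0 : 'I_n -> R) (s : 'I_m -> 'I_n -> R) (B : 'I_m -> 'M[R]_n)
  (hX : mixture_process P phi X pi0 s B)
  (Gamma : 'I_p -> {set state n})
  (Gamma_neq0 : forall l, Gamma l != finset.set0)
  (Gamma_closed : forall l, stoch_closed B (Gamma l))
  (Gamma_cap : (\bigcap_l Gamma l)%SET = [set absorb n]%SET)
  (pi0_neq0 : forall i, (forall l, trans i \notin Gamma l) -> pi0 i != 0)
  (tau_gt0 : P [set w | forall l, (0 < entry_time X (Gamma l) w)%E] = 1%E)
  (t : R) (t_ge0 : 0 <= t)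
  (tm : 'I_p -> R) (sigma : 'S_p)
  (tm_sorted : path <=%R t [seq tm (sigma l) | l : 'I_p])
  (F : set (set T)) (F_sigma : sigma_algebra setT F)
  (F_sub : F `<=` sigma_before X t)
  (cp : set T -> T -> R) (cpP : cond_prob_given P F cp)
  (c : 'I_m -> 'I_n -> T -> R)
  (c_ge0 : forall k i w, 0 <= c k i w)
  (c_sum1 : forall i w, \sum_k c k i w = 1)
  (j : 'I_n) :
  {ae P, forall w, 0 < cp [set w | X t w = trans j] w ->
    cond_prob_at cp X t (trans j)
      [set w | forall l : 'I_p,
         ((tm (sigma l))%:E < entry_time X (Gamma (sigma l)) w)%E] w
    = (\sum_(k < m)
         delta_mx 0 j *m regime_mx cp phi X t c k w
         *m (\prod_(l < p)
               (expm ((tm (sigma l)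
                       - nth t (t :: [seq tm (sigma l) | l : 'I_p]) l) *: B k)
                *m outside_mx (Gamma (sigma l))))
         *m (const_mx 1 : 'cV[R]_n)) (0 : 'I_1) (0 : 'I_1)}
  /\ {ae P, forall w, \sum_(k < m) regime_mx cp phi X t c k w = 1%:M}.
Proof.
have Fm : F `<=` measurable by move=> S /F_sub /(measurable_sigma_before hX).
have mk := mix_phi_measurable hX.
have mt x : measurable [set w | X t w = x] by exact: (mix_X_measurable hX).
split.
- pose v l := tm (sigma l); pose G l := Gamma (sigma l).
  pose r := [seq (v l, G l) | l : 'I_p].
  have rv : [seq e.1 | e <- r] = [seq v l | l : 'I_p] by rewrite -map_comp.
  have v0 l : 0 <= v l.
    move: tm_sorted; rewrite path_sortedE; last exact: le_trans.
    move=> /andP[/allP/(_ (v l)) + _]; rewrite map_f ?mem_enum// => /(_ isT).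
    exact: le_trans.
  have rG e : e \in r -> absorb n \in e.2.
    move=> /mapP[l _ ->] /=; have : absorb n \in (\bigcap_l Gamma l)%SET.
      by rewrite Gamma_cap finset.in_set1.
    by move/finset.bigcapP; exact.
  have GB l : stoch_closed B (G l) by exact: Gamma_closed.
  have mA : measurable [set w | forall l, ((v l)%:E < entry_time X (G l) w)%E].
    exact: (measurable_entry_times_gt hX).
  have mr : measurable (avoids X r).
    by apply: (measurable_avoids hX) => e /mapP[l _ ->]; exact: v0.
  pose M k := (avoidance_mx (B k) t r *m const_mx 1 : 'cV_n) j 0.
  have := @cond_prob_linear R d T P F cp 'I_m
    ([set w | forall l, ((v l)%:E < entry_time X (G l) w)%E] `&` [set w | X t w = trans j])
    (fun k => [set w | phi w = k] `&` [set w | X t w = trans j]) M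
    F_sigma Fm cpP (measurableI _ _ mA (mt _)) (fun k => measurableI _ _ (mk k) (mt _)).
  (* Entry times are replaced by avoidance, the event is split by regime, and each piece contributes
     its scalar factor [M k]. *)
  have key S : F S -> fine (P ([set w | forall l, ((v l)%:E < entry_time X (G l) w)%E]
      `&` [set w | X t w = trans j] `&` S)) =
      \sum_k M k * fine (P ([set w | phi w = k] `&` [set w | X t w = trans j] `&` S)).
    move=> FS; have mS := Fm _ FS.
    rewrite -setIA (fine_probability_entry_times hX)//; last exact: measurableI.
    rewrite (fine_probability_partition P mk); last first.
      by apply: measurableI => //; exact: measurableI.
    apply: eq_bigr => k _.
    rewrite -(mixture_avoidance_sigma_before hX)//; last 2 first.
    - by rewrite rv.
    - exact: F_sub.
    congr (fine (P _)).
    by apply/seteqP; split => [w [[? [? ?]] ?]|w [[[? ?] ?] ?]].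
  move=> /(_ key); apply: filterS => w cpE w0.
  rewrite /cond_prob_at cpE mulr_suml summxE; apply: eq_bigr => k _.
  (* The unit row selects row [j], where the diagonal regime matrix leaves its weight at [j] times
     [M k]. *)
  rewrite -(avoidance_mxE (B k) t v G) -!mulmxA -rowE mxE /regime_mx mul_diag_mx.
  rewrite mxE [X in _ = X * _]mxE w0 /cond_prob_at -/(M k).
  by rewrite -mulrA mulrC.
(* Additivity over regimes holds almost surely for the chosen version; it comes from the linear
   identity with unit coefficients. *)
- have H i : {ae P, forall w, cp [set w | X t w = trans i] w =
      \sum_k cp ([set w | phi w = k] `&` [set w | X t w = trans i]) w}.
    have := @cond_prob_linear R d T P F cp 'I_m [set w | X t w = trans i]
      (fun k => [set w | phi w = k] `&` [set w | X t w = trans i]) (cst 1)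
      F_sigma Fm cpP (mt _) (fun k => measurableI _ _ (mk k) (mt _)).
    have key S : F S -> fine (P ([set w | X t w = trans i] `&` S)) =
      \sum_k cst 1 k * fine (P ([set w | phi w = k] `&` [set w | X t w = trans i] `&` S)).
      move=> FS; have mS := Fm _ FS.
      rewrite (fine_probability_partition P mk); last exact: measurableI.
      by apply: eq_bigr => k _; rewrite mul1r setIC setIA.
    move=> /(_ key); apply: filterS => w ->.
    by apply: eq_bigr => k _; rewrite mul1r.
  have {}H : {ae P, forall w, forall i, cp [set w | X t w = trans i] w =
      \sum_k cp ([set w | phi w = k] `&` [set w | X t w = trans i]) w}.
    exact: filter_forall.
  apply: filterS H => w Hw.
  apply/matrixP => a b; rewrite summxE !mxE.
  under eq_bigr do rewrite !mxE.
  have [_|_] := eqVneq a b; last by rewrite big1.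
  rewrite mulr1n; under eq_bigr do rewrite mulr1n.
  (* Where the denominator is positive it equals the sum of the numerators; elsewhere the completion
     weights already sum to 1. *)
  have [w0|_] := ltP 0 (cp [set w | X t w = trans a] w); last exact: c_sum1.
  by rewrite /cond_prob_at -mulr_suml -Hw divff// gt_eqF.
Qed.
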